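(* For all integers $k,\ell$ with $1\leq k\leq \ell$, the polynomial \[C_{k-1}(q)\,C_{\ell+1}(q)-q^{\ell-k+1}\,C_k(q)\,C_\ell(q)\] has nonnegative coefficients.
   Context: For an integer $n\geq 0$, a lattice permutation with $n$ 1s and $n$ 2s is a word $\pi=\pi_1\cdots\pi_{2n}$ containing exactly $n$ letters $1$ and $n$ letters $2$ such that every initial segment $\pi_1\cdots\pi_j$ contains no more 2s than 1s. The inversion number ${\rm inv}\,\pi$ is the number of pairs $i<j$ with $\pi_i=2$ and $\pi_j=1$. The $q$-Catalan number is $C_n(q)=\sum_\pi q^{{\rm inv}\,\pi}$, the sum over all lattice permutations $\pi$ with $n$ 1s and $n$ 2s (so $C_0(q)=1$). Equivalently, $C_0(q)=1$ and $C_{n+1}(q)=\sum_{k=0}^n q^{(k+1)(n-k)}C_k(q)C_{n-k}(q)$. *)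

(* Defs.v *)
From mathcomp Require Import all_boot all_order all_algebra.

Set Implicit Arguments.
Unset Strict Implicit.
Unset Printing Implicit Defensive.

Import GRing.Theory Num.Theory.

(* Words over the alphabet {1, 2} are sequences of booleans. *)
Definition letter1 : bool := false.
Definition letter2 : bool := true.

Definition lattice_perm (n : nat) (w : n.*2.-tuple bool) : bool :=
  [&& count_mem letter1 w == n,
      count_mem letter2 w == n &
      [forall j : 'I_n.*2.+1,
         count_mem letter2 (take j w) <= count_mem letter1 (take j w)]].

(* inv w counts the pairs of positions i < j with w_i = 2 and w_j = 1. *)
Definition inv (m : nat) (w : m.-tuple bool) : nat :=
  #|[set p : 'I_m * 'I_m |
      [&& p.1 < p.2, tnth w p.1 == letter2 & tnth w p.2 == letter1]]|.

Local Open Scope ring_scope.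

Definition qCatalan (n : nat) : {poly int} :=
  \sum_(w : n.*2.-tuple bool | lattice_perm w) 'X^(inv w).

(* Main.v *)
Require Import Defs.
From mathcomp Require Import all_boot all_order all_algebra.
From mathcomp Require Import zify ring.

(** The statement is a Lindstrom-Gessel-Viennot argument.  Draw a word as a
    path with up steps 1 and down steps 2.  Given lattice permutations with [k]
    and [l] ones, shift them so that the long one starts before and ends before
    the short one; the paths then meet, and exchanging their tails at the first
    meeting point gives lattice permutations with [k - 1] and [l + 1] ones,
    while the total number of inversions grows by [l - k + 1].  Algebraically,
    one reads the two paths step by step from the left, so that the exchange
    becomes an induction on generating functions of suffixes. *)

Set Implicit Arguments.
Unset Strict Implicit.
Unset Printing Implicit Defensive.

Import GRing.Theory Num.Theory.

Local Open Scope ring_scope.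

(* The inversion enumerator of the words with [x] ones and [y] twos that
   complete a prefix having [y - x] more ones than twos to a lattice
   permutation; it is 0 when [x > y]. *)
Fixpoint ballot_poly (x : nat) : nat -> {poly int} :=
  match x with
  | 0%N => fun=> 1
  | x'.+1 => fix row (y : nat) : {poly int} :=
    match y with
    | 0%N => 0
    | y'.+1 =>
      if (x' <= y')%N then ballot_poly x' y + 'X^(x'.+1) * row y' else 0
    end
  end.

Lemma ballot_poly0 y : ballot_poly 0 y = 1.
Proof. by []. Qed.

Lemma ballot_polySS x y : (x <= y)%N ->
  ballot_poly x.+1 y.+1 = ballot_poly x y.+1 + 'X^(x.+1) * ballot_poly x.+1 y.
Proof. by move=> /= ->. Qed.

Lemma ballot_poly_gt x y : (y < x)%N -> ballot_poly x y = 0.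
Proof. by case: x y => [|x] [|y] //; rewrite ltnS => lt_yx /=; rewrite leqNgt lt_yx. Qed.

Definition nneg_poly (p : {poly int}) : Prop := forall i, 0 <= p`_i.

Lemma nneg_poly0 : nneg_poly 0.
Proof. by move=> i; rewrite coef0. Qed.

Lemma nneg_polyXn n : nneg_poly 'X^n.
Proof. by move=> i; rewrite coefXn ler0n. Qed.

Lemma nneg_polyD p q : nneg_poly p -> nneg_poly q -> nneg_poly (p + q).
Proof. by move=> p_ge0 q_ge0 i; rewrite coefD addr_ge0. Qed.

Lemma nneg_polyM p q : nneg_poly p -> nneg_poly q -> nneg_poly (p * q).
Proof.
by move=> p_ge0 q_ge0 i; rewrite coefM sumr_ge0 // => j _; rewrite mulr_ge0.
Qed.

Lemma ballot_poly_nneg x y : nneg_poly (ballot_poly x y).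
Proof.
elim: x y => [|x IHx] y; first exact: (nneg_polyXn 0).
elim: y => [|y IHy]; first exact: nneg_poly0.
have [le_xy|lt_yx] := leqP x y; last first.
  by rewrite ballot_poly_gt //; exact: nneg_poly0.
rewrite ballot_polySS //; apply: nneg_polyD => //.
by apply: nneg_polyM => //; exact: nneg_polyXn.
Qed.

(* Two paths start at the same time, the second one [2 d] higher, and one of
   them ends two steps later: they must meet when it is the lower one. *)
Lemma ballot_poly_exchange u y d : (u + d <= y)%N ->
  nneg_poly (ballot_poly (u + d) y * ballot_poly u.+1 (y + d).+1
             - 'X^d * (ballot_poly u (y + d) * ballot_poly (u + d).+1 y.+1)).
Proof.
have [n] := ubnP (u + d + y)%N; elim: n u y d => // n IHn u y [|d] lt_n le_udy.
  (* At distance 0 the paths have met, and exchanging tails leaves the product unchanged. *)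
  by rewrite !addn0 expr0 mul1r subrr; exact: nneg_poly0.
case: y le_udy lt_n => [|y] le_udy lt_n; first by lia.
(* Both paths now read one letter. The half-distance [d.+1] is kept if the letters agree
   ([down_nneg], [up_nneg]), drops to [d] if the lower path rises and the upper one falls
   ([meet_nneg]), and grows to [d.+2] in the opposite case ([apart_nneg]). A letter 2 weighs as many
   inversions as there are 1s left, which shifts the exponent of the subtracted product to the new
   half-distance. *)
have down_nneg : nneg_poly
     (ballot_poly (u + d).+1 y * ballot_poly u.+1 (y + d).+2
     - 'X^(d.+1) * (ballot_poly u (y + d).+1 * ballot_poly (u + d).+2 y.+1)).
  have [lt_udy|ge_udy] := ltnP (u + d) y.
    by have := IHn u y d.+1; rewrite !addnS; apply; lia.
  (* The lower path is on the axis and cannot fall: both products vanish. *)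
  rewrite (@ballot_poly_gt (u + d).+1 y) ?(@ballot_poly_gt (u + d).+2 y.+1) //.
  by rewrite mul0r !mulr0 subr0; exact: nneg_poly0.
have {}down_nneg := nneg_polyM (nneg_polyXn (u + u + d).+2) down_nneg.
have := IHn u y.+1 d; rewrite !addnS !addSn.
move=> /(_ ltac:(lia) ltac:(lia)) /(nneg_polyM (nneg_polyXn u.+1)) meet_nneg.
rewrite [ballot_poly (u + d).+1 y.+1]ballot_polySS; last by lia.
rewrite [ballot_poly u.+1 (y + d).+3]ballot_polySS; last by lia.
rewrite [ballot_poly (u + d).+2 y.+2]ballot_polySS; last by lia.
(* For [u = 0] the upper path of the subtracted product has only 2s left, so the cases where the
   upper path rises contribute to the positive product alone. *)
case: u => [|u] in lt_n le_udy down_nneg meet_nneg *.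
  have up_nneg : nneg_poly
      ((ballot_poly d y.+1 + 'X^(d.+1) * ballot_poly d.+1 y)
       * ballot_poly 0 (y + d).+3).
    apply: nneg_polyM (ballot_poly_nneg _ _).
    apply: nneg_polyD (ballot_poly_nneg _ _) _.
    exact: nneg_polyM (nneg_polyXn _) (ballot_poly_nneg _ _).
  have := nneg_polyD up_nneg (nneg_polyD meet_nneg down_nneg).
  rewrite !add0n !ballot_poly0; congr nneg_poly.
  by rewrite !exprS; ring.
have up_nneg := IHn u y.+1 d.+1 ltac:(lia) ltac:(lia).
have apart_nneg : nneg_poly
     (ballot_poly (u + d).+2 y * ballot_poly u.+1 (y + d).+3
     - 'X^(d.+2) * (ballot_poly u (y + d).+2 * ballot_poly (u + d).+3 y.+1)).
  have [lt_udy|ge_udy] := ltnP (u + d).+1 y.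
    by have := IHn u y d.+2; rewrite !addnS; apply; lia.
  rewrite (@ballot_poly_gt (u + d).+2 y) ?(@ballot_poly_gt (u + d).+3 y.+1) //.
  by rewrite mul0r !mulr0 subr0; exact: nneg_poly0.
have {}apart_nneg := nneg_polyM (nneg_polyXn (u + d).+2) apart_nneg.
have := nneg_polyD (nneg_polyD up_nneg apart_nneg)
                   (nneg_polyD meet_nneg down_nneg).
rewrite [ballot_poly u.+1 (y + d).+2]ballot_polySS; last by lia.
rewrite !addnS !addSn; congr nneg_poly.
by rewrite !exprS !exprD; ring.
Qed.

(** This treats the stretch of the long path before the short one starts: while [p + r] exceeds
    [n + n], only the long path reads a letter. At equality both start together, with [d = n - p] in
    [ballot_poly_exchange]. *)
Lemma ballot_poly_exchange_shift n p r : (p <= r)%N -> (n + n <= p + r)%N ->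
  nneg_poly (ballot_poly n n * ballot_poly p.+1 r.+1
             - 'X^(r - n) * (ballot_poly p r * ballot_poly n.+1 n.+1)).
Proof.
have [s] := ubnP (p + r)%N; elim: s p r => // s IHs p r lt_s le_pr.
rewrite leq_eqVlt => /orP[/eqP sum_pr | lt_nnpr].
  have := @ballot_poly_exchange p n (n - p); rewrite subnKC; last by lia.
  have -> : (n + (n - p) = r)%N by lia.
  have -> : (n - p = r - n)%N by lia.
  exact.
case: r => [|r] in lt_s le_pr lt_nnpr *; first by lia.
have down_nneg : nneg_poly (ballot_poly n n * ballot_poly p.+1 r.+1
    - 'X^(r - n) * (ballot_poly p r * ballot_poly n.+1 n.+1)).
  have [le_pr'|lt_rp] := leqP p r; first by apply: IHs; lia.
  rewrite (@ballot_poly_gt p.+1 r.+1) ?(@ballot_poly_gt p r) //.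
  by rewrite mul0r !mulr0 subr0; exact: nneg_poly0.
have {}down_nneg := nneg_polyM (nneg_polyXn p.+1) down_nneg.
rewrite [ballot_poly p.+1 r.+2]ballot_polySS; last by lia.
rewrite (@subSn n r); last by lia.
case: p => [|p] in lt_s le_pr lt_nnpr down_nneg *.
  have := nneg_polyD (nneg_polyM (ballot_poly_nneg n n)
                               (ballot_poly_nneg 0 r.+2)) down_nneg.
  rewrite !ballot_poly0; congr nneg_poly.
  by rewrite !exprS; ring.
rewrite [ballot_poly p.+1 r.+1]ballot_polySS; last by lia.
have := IHs p r.+1 ltac:(lia) ltac:(lia) ltac:(lia).
rewrite subSn; last by lia.
move=> /nneg_polyD/(_ down_nneg); congr nneg_poly.
by rewrite !exprS; ring.
Qed.

Fixpoint ballot (h : nat) (s : seq bool) : bool :=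
  match s with
  | [::] => true
  | false :: s' => ballot h.+1 s'
  | true :: s' => if h is h'.+1 then ballot h' s' else false
  end.

Lemma ballotP h s :
  reflect (forall j, (j <= size s)%N ->
             (count_mem true (take j s) <= h + count_mem false (take j s))%N)
          (ballot h s).
Proof.
elim: s h => [|[] s IHs] h /=; first by apply: ReflectT => -[|j].
  case: h => [|h].
    by apply: ReflectF => /(_ 1%N isT); rewrite /= take0.
  apply: (iffP (IHs h)) => [pre [|j] le_js|pre j le_js] //=.
    by rewrite add0n add1n addSn ltnS pre.
  by have := pre j.+1 le_js; rewrite /= add0n add1n addSn ltnS.
apply: (iffP (IHs h.+1)) => [pre [|j] le_js|pre j le_js] //=.
  by rewrite add0n add1n addnS -addSn pre.
by have := pre j.+1 le_js; rewrite /= add0n add1n addnS -addSn.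
Qed.

(** Inversions are grouped by their left position, to follow a recursion on the first letter. *)
Fixpoint seq_inv (s : seq bool) : nat :=
  if s is b :: s' then (b * count_mem false s' + seq_inv s')%N else 0%N.

Lemma big_tuple_cons (R : Type) (idx : R) (op : Monoid.com_law idx)
    (T : finType) m (P : pred (m.+1.-tuple T)) (F : m.+1.-tuple T -> R) :
  \big[op/idx]_(w : m.+1.-tuple T | P w) F w =
  \big[op/idx]_(b : T) \big[op/idx]_(w : m.-tuple T | P [tuple of b :: w])
     F [tuple of b :: w].
Proof.
rewrite pair_big_dep /=.
rewrite (reindex (fun p : T * m.-tuple T => [tuple of p.1 :: p.2])) //=.
exists (fun w => (thead w, [tuple of behead w])) => [[b w] _|w _] /=.
  by rewrite theadE; congr pair; apply: val_inj.
by rewrite -tuple_eta.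
Qed.

Lemma inv_sum m (w : m.-tuple bool) :
  Defs.inv w = (\sum_(i < m) \sum_(j < m)
                   [&& i < j, tnth w i & ~~ tnth w j])%N.
Proof.
rewrite /Defs.inv -sum1dep_card big_mkcond pair_bigA /=.
apply: eq_bigr => -[i j] _ /=; rewrite eqb_id eqbF_neg.
by case: ifP => // _.
Qed.

Lemma inv_cons m b (w : m.-tuple bool) :
  Defs.inv [tuple of b :: w] = (b * count_mem false w + Defs.inv w)%N.
Proof.
rewrite !inv_sum big_ord_recl big_ord_recl /=; congr addn.
  rewrite add0n -sum1_count big_tuple big_distrr [RHS]big_mkcond /=; apply: eq_bigr => j _.
  by rewrite tnthS; case: b; case: (tnth w j).
apply: eq_bigr => i _; rewrite big_ord_recl add0n.
by apply: eq_bigr => j _; rewrite !tnthS.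
Qed.

Lemma inv_seq_inv m (w : m.-tuple bool) : Defs.inv w = seq_inv w.
Proof.
elim: m w => [|m IHm] w.
  by rewrite tuple0 /Defs.inv eq_card0 // => -[[]].
case/tupleP: w => b w; rewrite inv_cons IHm.
by [].
Qed.

(** Splitting on the first letter gives the recurrence of [ballot_poly]: a leading 2 is inverted
    with all [x] later 1s, a leading 1 with nothing. *)
Lemma sum_ballot_poly m x y : (x + y = m)%N -> (x <= y)%N ->
  \sum_(w : m.-tuple bool | [&& count_mem false w == x, count_mem true w == y
     & ballot (y - x) w]) 'X^(seq_inv w) = ballot_poly x y.
Proof.
elim: m x y => [|m IHm] x y sum_xy le_xy.
  have [-> ->] : x = 0%N /\ y = 0%N by lia.
  rewrite (big_pred1 [tuple]) => [|w]; first by rewrite expr0.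
  by rewrite tuple0 /= eqxx.
case: y => [|y] in sum_xy le_xy *; first by lia.
rewrite big_tuple_cons /= big_bool /=.
have -> : \sum_(w : m.-tuple bool | [&& (0 + count_mem false w)%N == x,
      (1 + count_mem true w)%N == y.+1
    & if (y.+1 - x)%N is h.+1 then ballot h w else false])
      'X^(1 * count_mem false w + seq_inv w) = 'X^x * ballot_poly x y.
  have [le_xy'|lt_yx] := leqP x y; last first.
    (* At height 0 no word may start with 2, which matches the value 0 of [ballot_poly] for
       [x > y]. *)
    have -> : (y.+1 - x)%N = 0%N by lia.
    by rewrite ballot_poly_gt // mulr0 big_pred0 // => w; rewrite !andbF.
  rewrite -IHm //; last by lia.
  rewrite big_distrr subSn //=; apply: eq_big => [w|w /andP[/eqP <- _]].
    by rewrite add0n add1n eqSS.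
  by rewrite mul1n exprD.
case: x => [|x] in sum_xy le_xy *.
  by rewrite big_pred0 // expr0 mul1r addr0 ballot_poly0.
rewrite ballot_polySS // addrC -[ballot_poly x y.+1]IHm; [|lia..]; congr (_ + _).
apply: eq_big => [w|w _]; last by rewrite mul0n.
by rewrite add0n add1n eqSS subSS -subSn.
Qed.

Lemma qCatalan_ballot_poly n : qCatalan n = ballot_poly n n.
Proof.
rewrite -(@sum_ballot_poly n.*2) ?addnn // /qCatalan; apply: eq_big => [w|w _].
  congr [&& _, _ & _]; rewrite subnn; apply/forallP/ballotP => [pre j le_jn|pre j].
    rewrite size_tuple -ltnS in le_jn; exact: (pre (Ordinal le_jn)).
  by apply: pre; rewrite size_tuple -ltnS.
by rewrite inv_seq_inv.
Qed.

Theorem mainTheorem1 (k l : nat) (hk : (1 <= k)%N) (hkl : (k <= l)%N) (i : nat) :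
  0 <= (qCatalan (k - 1) * qCatalan (l + 1)
        - 'X^(l - k + 1) * (qCatalan k * qCatalan l))`_i.
Proof.
case: k hk hkl => // k _ lt_kl.
rewrite !qCatalan_ballot_poly subn1 !addn1 subnSK // [X in _ - _ * X]mulrC.
(* Here [n = k], one less than the [k] of the statement, and [p = r = l]: nothing has been read
   yet. *)
by apply: ballot_poly_exchange_shift; lia.
Qed.
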